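(* Let $G$ be a periodic near abelian locally compact group with base $A$ such that $G$ is $A$-nontrivial. Let $D$ be the largest divisible subgroup of the periodic inductively monothetic group $G/A$, i.e. the closed subgroup of elements of $G/A$ whose $p$-primary components vanish for every prime $p$ for which $(G/A)_p$ is not divisible, and let $G_D$ be the full preimage of $D$ under the quotient map $G\to G/A$. Then $A\subseteq G_D\subseteq C_G(A)$, $G_D$ is an abelian normal subgroup of $G$, and $G/G_D$ is $\Pi$-procyclic.
   Context: A topological group $G$ is periodic if it is locally compact, totally disconnected, and $\overline{\langle g\rangle}$ is compact for every $g\in G$. A topological group is inductively monothetic if for every finite subset $F$ there is $g$ with $\overline{\langle F\rangle}=\overline{\langle g\rangle}$. A topological group $G$ is near abelian if it is locally compact and contains a closed abelian subgroup $A$ (a base) such that $G/A$ is an abelian inductively monothetic group and every closed subgroup of $A$ is normal in $G$. With $\psi\colon G/A\to\mathrm{Aut}(A)$, $\psi(gA)(a)=gag^{-1}$, $G$ is $A$-nontrivial if $\psi(G/A)$ has more than $2$ elements. For a periodic locally compact abelian group $B$ and a prime $p$, the $p$-primary component $B_p$ is the set of $b\in B$ such that $\overline{\langle b\rangle}$ is a pro-$p$ group. A topological group $B$ is $\Pi$-procyclic if it is a periodic locally compact abelian group each of whose $p$-primary components $B_p$ is either a finite cyclic $p$-group (possibly trivial) or isomorphic to the $p$-adic integers $\mathbb{Z}_p$. $C_G(A)$ denotes the centraliser of $A$ in $G$. *)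

(* Defs.v *)
From HB Require Import structures.
From mathcomp Require Import all_boot all_order all_algebra.
From mathcomp Require Import all_classical topology.
Set Implicit Arguments. Unset Strict Implicit. Unset Printing Implicit Defensive.
Import Order.TTheory GRing.Theory Num.Theory.
Local Open Scope classical_set_scope.

Record topGroup := TopGroup {
  tg_sort :> topologicalType;
  tg_mul : tg_sort -> tg_sort -> tg_sort;
  tg_inv : tg_sort -> tg_sort;
  tg_one : tg_sort;
  tg_mulA : forall x y z, tg_mul x (tg_mul y z) = tg_mul (tg_mul x y) z;
  tg_mul1g : forall x, tg_mul tg_one x = x;
  tg_mulg1 : forall x, tg_mul x tg_one = x;
  tg_mulVg : forall x, tg_mul (tg_inv x) x = tg_one;
  tg_mulgV : forall x, tg_mul x (tg_inv x) = tg_one;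
  tg_mul_cont : continuous (fun xy : tg_sort * tg_sort => tg_mul xy.1 xy.2);
  tg_inv_cont : continuous tg_inv }.

Arguments tg_mul {t}. Arguments tg_inv {t}. Arguments tg_one {t}.

Section TopGroupDefs.
Variable G : topGroup.
Implicit Types (H K U N S : set G) (x y g : G).

Definition conjg x g := tg_mul g (tg_mul x (tg_inv g)).

Fixpoint gpow g (n : nat) : G :=
  if n is n'.+1 then tg_mul g (gpow g n') else tg_one.

Definition zpow g (z : int) : G :=
  match z with Posz n => gpow g n | Negz n => tg_inv (gpow g n.+1) end.

Definition cyc g : set G := [set zpow g z | z in [set: int]].

Definition is_subgroup S :=
  S tg_one /\ forall x y, S x -> S y -> S (tg_mul x (tg_inv y)).

Definition normal_sub N :=
  is_subgroup N /\ forall g x, N x -> N (conjg x g).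

Definition abelian_set S :=
  forall x y, S x -> S y -> tg_mul x y = tg_mul y x.

Definition abelian_group := abelian_set [set: G].

Definition gen S : set G :=
  \bigcap_(H in [set H : set G | is_subgroup H /\ S `<=` H]) H.

Definition centraliser S : set G :=
  [set g | forall a, S a -> tg_mul g a = tg_mul a g].

Definition LC_group := hausdorff_space G /\ locally_compact [set: G].

Definition periodic_group :=
  [/\ LC_group, totally_disconnected [set: G] &
      forall g, compact (closure (cyc g))].

Definition inductively_monothetic :=
  forall F : set G, finite_set F ->
    exists g, closure (gen F) = closure (cyc g).

Definition rel_open K U := exists O : set G, open O /\ U = K `&` O.

Definition index_ppow (p : nat) K U :=
  exists (k : nat) (s : seq G),
    [/\ size s = (p ^ k)%N,
        forall x, x \in s -> K x,
        (forall y, K y -> exists2 x, x \in s & U (tg_mul (tg_inv x) y)) &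
        forall i j, (i < size s)%N -> (j < size s)%N -> i <> j ->
          ~ U (tg_mul (tg_inv (nth tg_one s i)) (nth tg_one s j))].

Definition pro_p (p : nat) K :=
  [/\ is_subgroup K, compact K, totally_disconnected K &
      forall U, is_subgroup U -> U `<=` K ->
        (forall k u, K k -> U u -> U (conjg u k)) ->
        rel_open K U -> index_ppow p K U].

Definition primary (p : nat) S : set G :=
  [set b | S b /\ pro_p p (closure (cyc b))].

Definition divisible S :=
  forall y, S y -> forall n : nat, (0 < n)%N -> exists2 z, S z & gpow z n = y.

(** the p-primary component of the element x vanishes, i.e. the
    p-primary component of the procyclic group cl<x> is trivial *)
Definition pcomp_trivial (p : nat) x :=
  forall y, closure (cyc x) y -> pro_p p (closure (cyc y)) -> y = tg_one.

Definition div_part : set G :=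
  [set x | forall p, prime p -> ~ divisible (primary p [set: G]) ->
           pcomp_trivial p x].

Definition finite_cyclic_p (p : nat) S :=
  exists b (k : nat), S = [set gpow b i | i in [set i : nat | (i < p ^ k)%N]]
                      /\ gpow b (p ^ k) = tg_one.

End TopGroupDefs.

(** p-adic integers: compatible sequences (x n mod p^n) *)
Definition padic (p : nat) (x : nat -> nat) :=
  forall n, (x n < p ^ n)%N /\ (x n.+1 %% p ^ n)%N = x n.

Definition zp_add (p : nat) (x y : nat -> nat) : nat -> nat :=
  fun n => ((x n + y n) %% p ^ n)%N.

(** B is isomorphic, as a topological group (subspace topology), to Z_p
    with its p-adic topology (basic neighbourhoods {y | y n = x n}). *)
Definition iso_Zp (G : topGroup) (p : nat) (B : set G) :=
  exists phi : (nat -> nat) -> G,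
  [/\
      forall x, padic p x -> B (phi x),
      (forall b, B b -> exists2 x, padic p x & phi x = b),
      forall x y, padic p x -> padic p y -> phi x = phi y -> x = y,
      forall x y, padic p x -> padic p y ->
        phi (zp_add p x y) = tg_mul (phi x) (phi y) &
      (forall x, padic p x -> forall V, nbhs (phi x) V ->
        exists n, forall y, padic p y -> y n = x n -> V (phi y)) /\
      (forall x, padic p x -> forall n, exists2 V, nbhs (phi x) V &
        forall y, padic p y -> V (phi y) -> y n = x n)].

Definition Pi_procyclic (G : topGroup) :=
  [/\ periodic_group G, abelian_group G &
      forall p, prime p ->
        finite_cyclic_p p (primary p [set: G]) \/ iso_Zp p (primary p [set: G])].

Definition is_quotient (G Q : topGroup) (N : set G) (q : G -> Q) :=
  [/\ forall x y, q (tg_mul x y) = tg_mul (q x) (q y),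
      continuous q,
      forall U : set G, open U -> open (q @` U),
      forall z : Q, exists x, q x = z &
      forall x, q x = tg_one <-> N x].

Definition near_abelian (G Q : topGroup) (A : set G) (q : G -> Q) :=
  [/\ LC_group G, [/\ closed A, is_subgroup A & abelian_set A],
      is_quotient A q,
      abelian_group Q /\ inductively_monothetic Q &
      forall B : set G, closed B -> is_subgroup B -> B `<=` A -> normal_sub B].

(** psi(gA) = (a |-> g a g^-1) on A; A-nontrivial: psi(G/A) has > 2 elements *)
Definition psi_differ (G : topGroup) (A : set G) (g h : G) :=
  exists2 a, A a & conjg a g <> conjg a h.

Definition A_nontrivial (G : topGroup) (A : set G) :=
  exists g1 g2 g3 : G,
    [/\ psi_differ A g1 g2, psi_differ A g1 g3 & psi_differ A g2 g3].

(* Main.v *)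
Require Import Defs.
From mathcomp Require Import all_boot all_order all_algebra.
From mathcomp Require Import all_classical topology.
From mathcomp Require cyclic.
From mathcomp Require Import zify.
Set Implicit Arguments. Unset Strict Implicit. Unset Printing Implicit Defensive.
Local Open Scope classical_set_scope.

(** By van Dantzig's theorem the open subgroups of [G], hence those of [Q = G/A],
    form a basis at [1], so everything can be read off from the orders of elements
    modulo open subgroups. In a periodic abelian group an element is a [p]-element
    when all these orders are powers of [p], its [p]-component vanishes when they
    are all prime to [p], and every [x] splits as a product of two such elements of
    [cl<x>]. It follows that [D] is a divisible closed subgroup.

    [G_D] centralises [A]: for [a] in [A] and [U] open in [cl<a>], conjugation gives
    an action of [Q] on the finite cyclic group [cl<a>/U] whose exponent divides
    [totient #|cl<a>/U|], and elements of [D] are [totient #|cl<a>/U|]-th powers.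
    [G_D] is abelian: it is a central extension of the inductively monothetic [D].
    Finally, [(G/G_D)_p] is the image of [Q_p]; it is trivial if [Q_p] is divisible,
    and otherwise an element without [p]-th root topologically generates [Q_p]. *)

Declare Scope tg_scope.
Local Open Scope tg_scope.
Local Notation "x * y" := (tg_mul x y) : tg_scope.
Local Notation "x ^-1" := (tg_inv x) : tg_scope.
Local Notation "1" := tg_one : tg_scope.
Local Notation "x ^+ n" := (gpow x n) : tg_scope.

Local Notation conjg := Defs.conjg.

Definition cgen (G : topGroup) (x : G) : set G := closure (cyc x).

(** * Algebra of topological groups *)

Section Algebra.
Variable G : topGroup.
Implicit Types (x y z g : G) (U H : set G).

Lemma tg_mulKg x y : x^-1 * (x * y) = y.
Proof. by rewrite tg_mulA tg_mulVg tg_mul1g. Qed.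

Lemma tg_mulKVg x y : x * (x^-1 * y) = y.
Proof. by rewrite tg_mulA tg_mulgV tg_mul1g. Qed.

Lemma tg_mulgK x y : (y * x) * x^-1 = y.
Proof. by rewrite -tg_mulA tg_mulgV tg_mulg1. Qed.

Lemma tg_mulgKV x y : (y * x^-1) * x = y.
Proof. by rewrite -tg_mulA tg_mulVg tg_mulg1. Qed.

Lemma tg_invK x : x^-1^-1 = x.
Proof. by rewrite -[LHS]tg_mulg1 -(tg_mulVg x) tg_mulKg. Qed.

Lemma tg_inv_uniq x y : x * y = 1 -> y = x^-1.
Proof. by move=> xy1; rewrite -(tg_mulKg x y) xy1 tg_mulg1. Qed.

Lemma tg_invM x y : (x * y)^-1 = y^-1 * x^-1.
Proof.
by apply/esym/tg_inv_uniq; rewrite -tg_mulA tg_mulKVg tg_mulgV.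
Qed.

Lemma tg_inv1 : (1 : G)^-1 = 1.
Proof. by apply/esym/tg_inv_uniq; rewrite tg_mul1g. Qed.

Lemma tg_divg_eq1 x y : x^-1 * y = 1 -> y = x.
Proof. by move=> xy; rewrite -(tg_mulKVg x y) xy tg_mulg1. Qed.

Lemma gpowD x m n : x ^+ (m + n) = x ^+ m * x ^+ n.
Proof. by elim: m => [|m IH]; rewrite ?tg_mul1g //= IH tg_mulA. Qed.

Lemma gpow1 x : x ^+ 1%N = x. Proof. exact: tg_mulg1. Qed.

Lemma gpowM x m n : x ^+ (m * n)%N = x ^+ m ^+ n.
Proof. by elim: n => [|n IH]; rewrite ?muln0 // mulnS gpowD IH. Qed.

Lemma gpow1g n : (1 : G) ^+ n = 1.
Proof. by elim: n => //= n ->; rewrite tg_mul1g. Qed.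

Lemma gpowMn x y n : x * y = y * x -> (x * y) ^+ n = x ^+ n * y ^+ n.
Proof.
move=> xy; elim: n => [|n IH] /=; first by rewrite tg_mul1g.
have yxn : y * x ^+ n = x ^+ n * y.
  by elim: n {IH} => [|n IH] /=; rewrite ?tg_mulg1 ?tg_mul1g // tg_mulA -xy -tg_mulA IH tg_mulA.
by rewrite IH -!tg_mulA; congr (_ * _); rewrite !tg_mulA yxn.
Qed.

Lemma gpowVn x n : x^-1 ^+ n = (x ^+ n)^-1.
Proof.
apply: tg_inv_uniq; rewrite -gpowMn ?tg_mulgV ?gpow1g //.
by rewrite tg_mulVg.
Qed.

Lemma gpow_conjg x g n : conjg (x ^+ n) g = conjg x g ^+ n.
Proof.
elim: n => [|n IH] /=; first by rewrite /conjg tg_mul1g tg_mulgV.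
by rewrite -IH /conjg -!tg_mulA tg_mulKg.
Qed.

Lemma conjMg x y g : conjg (x * y) g = conjg x g * conjg y g.
Proof. by rewrite /conjg -!tg_mulA tg_mulKg. Qed.

Lemma conjgM x g h : conjg x (g * h) = conjg (conjg x h) g.
Proof. by rewrite /conjg tg_invM -!tg_mulA. Qed.

Lemma conjg1 x : conjg x 1 = x.
Proof. by rewrite /conjg tg_mul1g tg_inv1 tg_mulg1. Qed.

Lemma conjgK x g : conjg (conjg x g) g^-1 = x.
Proof. by rewrite -conjgM tg_mulVg conjg1. Qed.

Lemma conjVg x g : conjg x^-1 g = (conjg x g)^-1.
Proof. by apply: tg_inv_uniq; rewrite -conjMg tg_mulgV /conjg tg_mul1g tg_mulgV. Qed.

Lemma zpow_sub x (m n : nat) :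
  zpow x (Posz m - Posz n)%R = x ^+ m * (x ^+ n)^-1.
Proof.
have [le_nm|lt_mn] := leqP n m.
  have -> : (Posz m - Posz n)%R = Posz (m - n) by lia.
  by rewrite /= -{2}(subnK le_nm) gpowD tg_mulgK.
have -> : (Posz m - Posz n)%R = Negz (n - m).-1 by lia.
rewrite /zpow prednK ?subn_gt0 //.
by rewrite -{2}(subnK (ltnW lt_mn)) gpowD tg_invM tg_mulKVg.
Qed.

(** Quotients of two natural powers spare a sign analysis of integer exponents. *)
Lemma cycE x z : cyc x z <-> exists m n, z = x ^+ m * (x ^+ n)^-1.
Proof.
split=> [[k _ <-]|[m [n ->]]]; last by exists (Posz m - Posz n)%R; rewrite ?zpow_sub.
case: k => n; first by exists n, 0%N; rewrite /= tg_inv1 tg_mulg1.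
by exists 0%N, n.+1; rewrite /= tg_mul1g.
Qed.

Lemma gpowC x m n : x ^+ m * x ^+ n = x ^+ n * x ^+ m.
Proof. by rewrite -!gpowD addnC. Qed.

Lemma gpowVC x m n : x ^+ m * (x ^+ n)^-1 = (x ^+ n)^-1 * x ^+ m.
Proof. by rewrite -{1}(tg_mulKg (x ^+ n) (x ^+ m)) gpowC -!tg_mulA tg_mulgV tg_mulg1. Qed.

Lemma cyc_subgroup x : is_subgroup (cyc x).
Proof.
split=> [|y z /cycE[a [b ->]] /cycE[c [d ->]]].
  by apply/cycE; exists 0%N, 0%N; rewrite /= tg_mulgV.
apply/cycE; exists (a + d)%N, (c + b)%N.
by rewrite !gpowD !tg_invM tg_invK -!tg_mulA; congr (_ * _); rewrite !tg_mulA -gpowVC.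
Qed.

Lemma cyc_id x : cyc x x.
Proof. by apply/cycE; exists 1%N, 0%N; rewrite gpow1 /= tg_inv1 tg_mulg1. Qed.

(** * Orders and cosets modulo a subgroup *)

Section Subgroup.
Variables (H : set G) (sH : is_subgroup H).

Lemma sub1g : H 1. Proof. by case: sH. Qed.

Lemma subVg x : H x -> H x^-1.
Proof. by move=> Hx; rewrite -(tg_mul1g x^-1); apply: sH.2 => //; exact: sub1g. Qed.

Lemma subMg x y : H x -> H y -> H (x * y).
Proof. by move=> Hx Hy; rewrite -(tg_invK y); apply: sH.2 => //; exact: subVg. Qed.

Lemma subXg x n : H x -> H (x ^+ n).
Proof.
by move=> Hx; elim: n => [|n IH]; [exact: sub1g|exact: subMg].
Qed.

Lemma subMgl x y : H x -> H (x * y) <-> H y.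
Proof.
move=> Hx; split=> [Hxy|]; last exact: subMg.
by rewrite -(tg_mulKg x y); apply: subMg => //; exact: subVg.
Qed.

Lemma sub_coset_sym x y : H (x^-1 * y) -> H (y^-1 * x).
Proof. by move/subVg; rewrite tg_invM tg_invK. Qed.

Lemma sub_coset_trans x y z : H (x^-1 * y) -> H (y^-1 * z) -> H (x^-1 * z).
Proof.
by move=> xy yz; have := subMg xy yz; rewrite -tg_mulA tg_mulKVg.
Qed.

Lemma cyc_sub x : H x -> cyc x `<=` H.
Proof.
move=> Hx z /cycE[m [n ->]]; apply: sH.2; exact: subXg.
Qed.

Lemma coset_gpow x y n : x * y = y * x -> H (x^-1 * y) -> H ((x ^+ n)^-1 * y ^+ n).
Proof.
move=> xy Hxy; rewrite -gpowVn -gpowMn; first exact: subXg.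
by rewrite -{1}(tg_mulgK x y) -xy -!tg_mulA tg_mulKg.
Qed.

(** Take for [d] the least positive exponent with [H (x ^+ d)]; division with remainder does the
    rest. *)
Lemma order_mod x n : (0 < n)%N -> H (x ^+ n) ->
  exists2 d, (0 < d)%N & forall m, H (x ^+ m) <-> d %| m.
Proof.
move=> n0 Hxn.
have ex : exists k, (0 < k)%N && `[< H (x ^+ k) >] by exists n; rewrite n0; apply/asboolP.
have [d /andP[d0 /asboolP Hd] dmin] := ex_minnP ex.
exists d => // m; split=> [Hm|/dvdnP[q ->]]; last first.
  by rewrite mulnC gpowM; apply: subXg.
move: Hm; rewrite {1}(divn_eq m d) gpowD mulnC gpowM.
move=> /(subMgl _ (subXg _ Hd)) Hr.
have := ltn_pmod m d0; rewrite /dvdn; case: posnP => [/eqP//|r0].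
by rewrite ltnNge dmin // r0; apply/asboolP.
Qed.

(** The order of [x] modulo [H] divides both exponents, hence is 1. *)
Lemma coprime_gpow_sub x m n :
  coprime m n -> H (x ^+ m) -> H (x ^+ n) -> H x.
Proof.
case: (posnP m) => [->|m0]; first by rewrite /coprime gcd0n => /eqP ->; rewrite gpow1.
move=> mn Hm Hn; have [d d0 dE] := order_mod m0 Hm.
have : d %| gcdn m n by rewrite dvdn_gcd; apply/andP; split; apply/dE.
by rewrite (eqP mn) => /dE; rewrite gpow1.
Qed.

Lemma gpow_coset x d i j : (forall m, H (x ^+ m) <-> d %| m) ->
  H ((x ^+ i)^-1 * x ^+ j) <-> i = j %[mod d].
Proof.
move=> dE.
suff main a b : (a <= b)%N -> H ((x ^+ a)^-1 * x ^+ b) <-> a = b %[mod d].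
  have [/main//|/ltnW/main ji] := leqP i j.
  split=> [/sub_coset_sym/ji //|ij]; apply: sub_coset_sym; exact/ji.
move=> ab; rewrite -{1}(subnKC ab) gpowD tg_mulKg dE -(eqn_mod_dvd _ ab).
by split=> [/eqP|] -> //; exact/eqP.
Qed.

Lemma cyc_coset x n z : (0 < n)%N -> H (x ^+ n) -> cyc x z ->
  exists2 i, (i < n)%N & H ((x ^+ i)^-1 * z).
Proof.
move=> n0 Hn /cycE[a [b ->]].
(* Modulo [H], the inverse of [x ^+ b] is [x ^+ (b * n.-1)], because [x ^+ (b * n)] lies in [H]. *)
have Hi : H ((x ^+ (a + b * n.-1))^-1 * (x ^+ a * (x ^+ b)^-1)).
  rewrite gpowD tg_invM -!tg_mulA tg_mulKg -tg_invM -gpowD.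
  rewrite -{1}(muln1 b) -mulnDr add1n prednK // mulnC gpowM.
  by apply: subVg; exact: subXg.
have {Hi} [i Hi] : exists i, H ((x ^+ i)^-1 * (x ^+ a * (x ^+ b)^-1)).
  by exists (a + b * n.-1)%N.
exists (i %% n)%N; first exact: ltn_pmod.
apply: sub_coset_trans Hi.
rewrite {2}(divn_eq i n) addnC gpowD tg_mulKg mulnC gpowM; exact: subXg.
Qed.

End Subgroup.

Lemma subgroup1 : is_subgroup [set 1 : G].
Proof. by split=> // x y /= -> ->; rewrite tg_mulgV. Qed.

Lemma subgroupI U H : is_subgroup U -> is_subgroup H -> is_subgroup (U `&` H).
Proof.
move=> sU sH; split; first by split; [exact: sub1g|exact: sub1g].
by move=> x y [Ux Hx] [Uy Hy]; split; [exact: sU.2|exact: sH.2].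
Qed.

Lemma commute_subgroup z : is_subgroup [set y | z * y = y * z].
Proof.
split=> [|x y /= zx zy]; first by rewrite /= tg_mul1g tg_mulg1.
rewrite tg_mulA zx -!tg_mulA; congr (_ * _).
by rewrite -{1}(tg_mulKg y z) -zy -!tg_mulA tg_mulgV tg_mulg1.
Qed.

Lemma cyc_abelian x : abelian_set (cyc x).
Proof.
have xC y : x * y = y * x -> cyc x `<=` [set z | y * z = z * y].
  by move=> xy; apply: cyc_sub => //; exact: commute_subgroup.
by move=> y z /xC yx zx; apply: xC zx; rewrite -yx.
Qed.

Lemma sub_gen (S : set G) : S `<=` gen S.
Proof. by move=> x Sx H [_]; exact. Qed.

Lemma gen_min (S : set G) H : is_subgroup H -> S `<=` H -> gen S `<=` H.
Proof. by move=> sH SH x; exact. Qed.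

End Algebra.

(** * Open subgroups and closures *)

Section Topology.
Variable G : topGroup.
Implicit Types (x y z g : G) (U H S : set G).

Lemma continuousM (T : topologicalType) (f h : T -> G) :
  continuous f -> continuous h -> continuous (fun t => f t * h t).
Proof.
move=> cf ch t; apply: (cvg_comp2 (cf t) (ch t)).
exact: (@tg_mul_cont G (f t, h t)).
Qed.

Lemma tg_mull_cont g : continuous (fun x => g * x).
Proof. by apply: (continuousM (f := cst g) (h := id)) => x; [exact: cvg_cst|exact: cvg_id]. Qed.

Lemma tg_mulr_cont g : continuous (fun x => x * g).
Proof. by apply: (continuousM (f := id) (h := cst g)) => x; [exact: cvg_id|exact: cvg_cst]. Qed.

Lemma gpow_cont n : continuous (fun x => x ^+ n).
Proof.
elim: n => [|n IH]; first by move=> x; exact: cvg_cst.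
by apply: (continuousM (f := id)) IH => x; exact: cvg_id.
Qed.

Lemma nbhs_coset g U : nbhs 1 U -> nbhs g [set x | U (g^-1 * x)].
Proof.
by move=> U1; apply: (tg_mull_cont (g := g^-1)); rewrite tg_mulVg.
Qed.

Lemma nbhs_translate g N : nbhs g N -> nbhs 1 [set x | N (g * x)].
Proof. by move=> Ng; apply: (tg_mull_cont (g := g)); rewrite tg_mulg1. Qed.

Definition open_subgroup U := is_subgroup U /\ open U.

Lemma open_subgroup_nbhs1 U : open_subgroup U -> nbhs 1 U.
Proof. by move=> [sU oU]; apply: open_nbhs_nbhs; split => //; exact: sub1g. Qed.

Lemma subgroup_nbhs_open U : is_subgroup U -> nbhs 1 U -> open U.
Proof.
move=> sU U1; rewrite openE => x Ux; rewrite /interior.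
apply: filterS (nbhs_coset x U1) => y /= ?.
by rewrite -(subMgl sU _ (subVg sU Ux)).
Qed.

Lemma open_subgroup_closed U : open_subgroup U -> closed U.
Proof.
move=> Uo x /(_ _ (nbhs_coset x (open_subgroup_nbhs1 Uo)))[y [Uy]] /=.
by case: Uo => sU _; move=> /(sub_coset_sym sU) /(subMgl sU _ (subVg sU Uy)).
Qed.

Lemma open_subgroupI U V : open_subgroup U -> open_subgroup V -> open_subgroup (U `&` V).
Proof. by move=> [? ?] [? ?]; split; [exact: subgroupI|exact: openI]. Qed.

Lemma closure_subgroup S : is_subgroup S -> is_subgroup (closure S).
Proof.
move=> sS; split; first by apply: subset_closure; exact: sub1g.
have cd : continuous (fun xy : G * G => xy.1 * xy.2^-1).
  apply: continuousM; first by case=> a b; exact: cvg_fst.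
  case=> a b; apply: (@continuous_comp _ _ _ snd tg_inv); first exact: cvg_snd.
  exact: tg_inv_cont.
move=> x y Sx Sy N /(cd (x, y)) [[M M'] /= [xM yM'] sub].
have [a [Sa Ma]] := Sx _ xM; have [b [Sb Mb]] := Sy _ yM'.
by exists (a * b^-1); split; [exact: sS.2|exact: (sub (a, b))].
Qed.

Lemma closure_min S H : closed H -> S `<=` H -> closure S `<=` H.
Proof. by move=> cH SH x /(closureS SH)/cH. Qed.

Lemma cgen_subgroup x : is_subgroup (cgen x).
Proof. by apply: closure_subgroup; exact: cyc_subgroup. Qed.

Lemma cgen_closed x : closed (cgen x).
Proof. exact: closed_closure. Qed.

Lemma cgen_id x : cgen x x.
Proof. by apply: subset_closure; exact: cyc_id. Qed.

Lemma cgen_min x H : closed H -> is_subgroup H -> H x -> cgen x `<=` H.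
Proof. by move=> cH sH Hx; apply: closure_min => //; exact: cyc_sub. Qed.

Lemma closed_coset H g : closed H -> closed [set x | H (g^-1 * x)].
Proof. by move=> cH; apply: preimage_closed cH => x _; exact: tg_mull_cont. Qed.

Lemma commute_closed x : hausdorff_space G -> closed [set y | x * y = y * x].
Proof.
move=> hG y cy; apply: contrapT => /eqP xy.
have := hG; rewrite open_hausdorff => /(_ _ _ xy)[[A B] /= [+ +] [oA oB /eqP AB]].
rewrite !inE => Ay By.
have nA : nbhs y [set z | A (x * z)].
  by apply: tg_mull_cont; exact: open_nbhs_nbhs.
have nB : nbhs y [set z | B (z * x)].
  by apply: tg_mulr_cont; exact: open_nbhs_nbhs.
have [z [/= xz [Az Bz]]] := cy _ (filterI nA nB).
suff : (A `&` B) (x * z) by rewrite AB.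
by split=> //; rewrite xz.
Qed.

Lemma closure_abelian S : hausdorff_space G -> abelian_set S -> abelian_set (closure S).
Proof.
move=> hG aS.
have H x : S x -> closure S `<=` [set y | x * y = y * x].
  by move=> Sx; apply: closure_min; [exact: commute_closed|move=> y Sy; exact: aS].
move=> x y Sx Sy; suff : closure S `<=` [set x | y * x = x * y] by move=> /(_ _ Sx) ->.
apply: closure_min; first exact: commute_closed.
by move=> z Sz; rewrite /= (H z).
Qed.

(** Compactness enters in this form to produce limits of sequences of powers, which are then handled
    modulo open subgroups. *)
Lemma seq_cluster (K : set G) (u : nat -> G) : compact K -> (forall n, K (u n)) ->
  exists2 p, K p & forall U, open_subgroup U -> forall N,
    exists2 n, (N <= n)%N & U (p^-1 * u n).
Proof.
move=> cK Ku; have [|p [Kp clp]] := cK (u @ \oo) _.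
  by exists 0%N => // n _; exact: Ku.
exists p => // U oU N.
have uN : (u @ \oo) (u @` [set n | (N <= n)%N]) by exists N => // n /= Nn; exists n.
have [_ [[n Nn <-] Un]] := clp _ _ uN (nbhs_coset p (open_subgroup_nbhs1 oU)).
by exists n.
Qed.

End Topology.

(** * Van Dantzig's theorem *)

Section VanDantzig.
Variable G : topGroup.
Hypothesis hG : hausdorff_space G.
Hypothesis lcG : locally_compact [set: G].

Lemma compact_nbhs1 : exists2 K : set G, nbhs 1 K & compact K.
Proof.
have [K K1 [cK _]] := lcG (x := 1) I; exists K => //.
by move: K1; rewrite /within /=; apply: filterS => x; exact.
Qed.

(** The product [K2] of [K] with a compact neighbourhood of 1 is compact and has [B] in its
    interior, so the normality of compact Hausdorff spaces applies locally. *)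
Lemma compact_separation (K B C : set G) : compact K -> B `<=` K -> closed B -> closed C ->
  B `&` C = set0 -> exists O O' : set G,
  [/\ open O, open O', B `<=` O, C `<=` O' & O `&` O' = set0].
Proof.
move=> cK BK cB cC BC; have [K0 K01 cK0] := compact_nbhs1.
pose K2 := (fun xy : G * G => xy.1 * xy.2) @` (K `*` K0).
have cK2 : compact K2.
  apply: continuous_compact; last exact: compact_setX.
  by apply: continuous_subspaceT => x; exact: tg_mul_cont.
have BK2 : B `<=` K2°.
  move=> x /BK Kx; apply: filterS (nbhs_coset x K01) => y /= Hy.
  by exists (x, x^-1 * y); rewrite //= tg_mulKVg.
have nC : set_nbhs B (~` C).
  move=> x Bx; apply: open_nbhs_nbhs; split; first exact: closed_openC.
  by move=> Cx; suff : (B `&` C) x by rewrite BC.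
have [D nD DC] : filter_from (set_nbhs B) closure (~` C).
  have normB := compact_normal_local hG cK2 BK2; exact: (normB cB _ nC).
exists D°, (~` closure D); split.
- exact: open_interior.
- by apply: closed_openC; exact: closed_closure.
- by move=> x /nD.
- by move=> x Cx /DC.
- by rewrite -subset0 => x [/interior_subset/subset_closure].
Qed.

(** For closed [K] these are the relatively clopen subsets of [K], phrased with closed sets of [G]
    to avoid the subspace topology. *)
Definition rel_clopen (K C : set G) := [/\ C `<=` K, closed C & closed (K `\` C)].

Definition quasi_component (K : set G) x : set G :=
  \bigcap_(C in [set C | rel_clopen K C /\ C x]) C.

Lemma rel_clopenI K C C' : rel_clopen K C -> rel_clopen K C' -> rel_clopen K (C `&` C').
Proof.
move=> [CK cC cKC] [C'K cC' cKC']; split; first by move=> x [/CK].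
  exact: closedI.
by rewrite setDIr; exact: closedU.
Qed.

(** Otherwise the sets [C] minus [O], with [C] relatively clopen around [x], generate a proper
    filter on [K]. A cluster point lies in every such [C], hence in [O]; but its neighbourhoods all
    meet the complement of [O]. *)
Lemma quasi_component_nbhs K x O : compact K -> K x -> open O ->
  quasi_component K x `<=` O -> exists C, [/\ rel_clopen K C, C x & C `<=` O].
Proof.
move=> cK Kx oO QO; apply: contrapT => nC.
have cKc : closed K by exact: compact_closed.
have Kr : rel_clopen K K by split => //; rewrite setDv; exact: closed0.
pose F := filter_from [set C | rel_clopen K C /\ C x] (fun C => C `\` O).
have PF : ProperFilter F.
  apply: filter_from_proper; first apply: filter_from_filter.
  - by exists K.
  - move=> C C' [rC Cx] [rC' C'x]; exists (C `&` C').
      by split; [exact: rel_clopenI|].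
    by move=> y [[Cy C'y] Oy]; split; split.
  move=> C [rC Cx]; apply: contrapT => /nonemptyPn CO; apply: nC; exists C; split => //.
  by rewrite -setD_eq0.
have [|y [Ky yF]] := cK F _; first by exists K => // y [].
suff Oy : O y.
  have [z [[_ nOz] Oz]] : (K `\` O) `&` O !=set0.
    by apply: yF; [exists K|exact: open_nbhs_nbhs].
  exact: nOz.
apply: QO => C [rC Cx]; case: (rC) => _ cC _; apply: cC => N Ny.
have [z [[Cz _] Nz]] : (C `\` O) `&` N !=set0 by apply: yF => //; exists C.
by exists z.
Qed.

(** Suppose it splits into two closed pieces. Disjoint open sets [O] and [O'] separate them, and
    some relatively clopen [C] around [x] lies in their union. The trace of [C] on [O] is again
    relatively clopen and contains [x], so the quasi-component misses the second piece, which is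
    nonempty. *)
Lemma quasi_component_connected K x : compact K -> K x -> connected (quasi_component K x).
Proof.
move=> cK Kx; apply/connectedP => E [E0 QE [s1 s2]].
have cKc : closed K by exact: compact_closed.
have cQ : closed (quasi_component K x).
  by apply: closed_bigI => C [[]].
have QK : quasi_component K x `<=` K.
  by apply: bigcap_inf; split => //; split => //; rewrite setDv; exact: closed0.
have EQ b : E b `<=` quasi_component K x by rewrite QE; case: b => y; [right|left].
have disj b : E b `&` E (~~ b) = set0.
  case: b => /=; rewrite -subset0.
    by rewrite -s1 => y [Et Ef]; split => //; exact: subset_closure.
  by rewrite -s1 => y [Ef Et]; split => //; exact: subset_closure.
have cE b : closed (E b).
  move=> y Ey; have : quasi_component K x y by apply: cQ; exact: closureS Ey.
  rewrite QE; case: b Ey => Ey [] // Ey'.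
    by suff : (E false `&` closure (E true)) y by rewrite s2.
  by suff : (closure (E false) `&` E true) y by rewrite s1.
have : quasi_component K x x by move=> C [].
rewrite QE => xE; have [b Ebx] : exists b, E b x by case: xE; [exists false|exists true].
have [O [O' [oO oO' EO EO' OO']]] :=
  compact_separation cK (subset_trans (EQ b) QK) (cE b) (cE (~~ b)) (disj b).
have [|C [[CK cC cKC] Cx CO]] := quasi_component_nbhs cK Kx (openU oO oO').
  rewrite QE; case: (b) EO EO' => /= EO EO' y.
    by move=> [/EO'|/EO]; [right|left].
  by move=> [/EO|/EO']; [left|right].
have C'E : C `&` O = C `\` O'.
  apply/seteqP; split=> y [Cy Oy]; split=> //.
    by move=> O'y; suff : (O `&` O') y by rewrite OO'.
  by case: (CO _ Cy).
have [y Ey] := E0 (~~ b).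
have [_ Oy] : (C `&` O) y.
  apply: EQ Ey _ _; split; last by split => //; exact: EO.
  split; first by move=> z [/CK].
    by rewrite C'E setDE; apply: closedI => //; exact: open_closedC.
  rewrite setDIr; apply: closedU => //; rewrite setDE; apply: closedI => //.
  exact: open_closedC.
suff : (O `&` O') y by rewrite OO'.
by split => //; exact: EO'.
Qed.

Hypothesis tdG : totally_disconnected [set: G].

Lemma compact_open_basis N : nbhs 1 N -> exists C : set G,
  [/\ compact C, open C, C 1 & C `<=` N].
Proof.
move=> N1; have [K K1 cK] := compact_nbhs1.
have Kg1 : K 1 := nbhs_singleton K1.
pose W := (K `&` N)°.
have W1 : W 1 by exact: filterI.
have [||C [[CK cC cKC] C1 CW]] := @quasi_component_nbhs K 1 W cK Kg1.
- exact: open_interior.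
- move=> y Qy; suff -> : y = 1 by [].
  have : connected_component [set: G] 1 y.
    exists (quasi_component K 1) => //; split => //; first by move=> C [].
    exact: quasi_component_connected.
  by rewrite tdG.
exists C; split => //; last by move=> y /CW/interior_subset[].
  by apply: subclosed_compact cK CK.
(* [C] is open in [G], not only in [K], because it lies in the open set [W], itself a subset of
   [K]. *)
have -> : C = W `&` ~` (K `\` C).
  apply/seteqP; split=> y; first by move=> Cy; split; [exact: CW|case].
  move=> [/interior_subset[Ky _] nKC]; apply: contrapT => nCy; exact: nKC.
apply: openI; first exact: open_interior.
exact: closed_openC.
Qed.

(* The right stabiliser of a compact open neighbourhood of 1 is open. *)
Lemma van_dantzig N : nbhs 1 N -> exists2 U : set G, open_subgroup U & U `<=` N.
Proof.
move=> /compact_open_basis[C [cC oC C1 CN]].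
pose H := [set g | forall c, C c <-> C (c * g)].
have sH : is_subgroup H.
  split=> [c|g h Hg Hh c]; first by rewrite tg_mulg1.
  have cgh : c * (g * h^-1) * h = c * g by rewrite -tg_mulA tg_mulgKV.
  split=> [Cc|/(Hh _).1]; first by apply/Hh; rewrite cgh; exact: (Hg c).1.
  by rewrite cgh => /(Hg c).2.
exists H; last by move=> g Hg; apply: CN; rewrite -(tg_mul1g g); exact: (Hg _).1.
split=> //; apply: subgroup_nbhs_open => //.
(* Tube lemma: one neighbourhood of 1 serves all points of the compact set [C]. *)
have nV : \forall g \near nbhs (1 : G), C `<=` (fun c => C (c * g)).
  move/compact_near_coveringP : cC; apply => c Cc.
  have : nbhs (c * 1) C by rewrite tg_mulg1; exact: open_nbhs_nbhs.
  move=> /(@tg_mul_cont G (c, 1)) [[A B] /= [cA B1] AB].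
  by exists (A, B) => //= -[a b] [/= Aa Bb]; exact: (AB (a, b)).
have nV' : nbhs (1 : G) [set g | C `<=` (fun c => C (c * g^-1))].
  by move: nV; rewrite -{1}(tg_inv1 G) => /(tg_inv_cont (x := 1)).
apply: filterS (filterI nV nV') => g [/= Cg Cg'] c; split; first exact: Cg.
by move=> /Cg'; rewrite tg_mulgK.
Qed.

End VanDantzig.

(** * Periodic groups described by their open subgroups *)

Definition open_subgroup_basis (G : topGroup) :=
  forall N : set G, nbhs 1 N -> exists2 U, open_subgroup U & U `<=` N.

(** An equivalent of [periodic_group] in which a basis of open subgroups replaces total
    disconnectedness; such a basis is carried to quotients by taking images. *)
Definition tdlc_periodic (G : topGroup) :=
  [/\ hausdorff_space G, locally_compact [set: G], open_subgroup_basis G &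
      forall g : G, compact (cgen g)].

Section OpenSubgroups.
Variable G : topGroup.
Implicit Types (x y g : G) (U S : set G).
Hypothesis pG : tdlc_periodic G.

Lemma open_subgroup_eq1 x : (forall U, open_subgroup U -> U x) -> x = 1.
Proof.
case: pG => hG _ bG _ Ux; apply/esym/hG => A B A1 Bx.
have [U Uo UA] := bG _ A1; exists x; split; last exact: nbhs_singleton.
exact: (UA _ (Ux _ Uo)).
Qed.

Lemma in_closure S x :
  closure S x <-> forall U, open_subgroup U -> exists2 s, S s & U (s^-1 * x).
Proof.
case: pG => hG _ bG _; split=> [Sx U Uo|H N Nx].
  have [s [Ss Us]] := Sx _ (nbhs_coset x (open_subgroup_nbhs1 Uo)).
  by exists s => //; apply: (sub_coset_sym Uo.1).
have [U Uo UN] := bG _ (nbhs_translate Nx); have [s Ss Us] := H _ Uo; exists s; split=> //.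
by have /UN /= := sub_coset_sym Uo.1 Us; rewrite tg_mulKVg.
Qed.

(** Two powers of [x] with different exponents lie in the same coset of [U], that of a cluster point
    [p] of all powers. *)
Lemma torsion_mod U x : open_subgroup U -> exists2 n, (0 < n)%N & U (x ^+ n).
Proof.
case: pG => _ _ _ cG Uo; have sU := Uo.1.
have [p _ clp] : exists2 p, cgen x p & forall U, open_subgroup U -> forall N,
    exists2 n, (N <= n)%N & U (p^-1 * x ^+ n).
  apply: (seq_cluster (cG x)) => n; apply: (subXg (cgen_subgroup x)).
  exact: cgen_id.
have [n _ Un] := clp _ Uo 0%N; have [m nm Um] := clp _ Uo n.+1.
exists (m - n)%N; first by rewrite subn_gt0.
have := sub_coset_trans sU (sub_coset_sym sU Un) Um.
by rewrite -{1}(subnKC (ltnW nm)) gpowD tg_mulKg.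
Qed.

Lemma cgen_coset U x z : open_subgroup U -> cgen x z -> exists i, U ((x ^+ i)^-1 * z).
Proof.
move=> Uo /in_closure/(_ U Uo)[s sx Us]; have [n n0 Un] := torsion_mod x Uo.
have [i _ Ui] := cyc_coset Uo.1 n0 Un sx; exists i.
exact: (sub_coset_trans Uo.1 Ui Us).
Qed.

Lemma in_cgen x z : (forall U, open_subgroup U -> exists i, U ((x ^+ i)^-1 * z)) -> cgen x z.
Proof.
move=> H; apply/in_closure => U Uo; have [i Ui] := H _ Uo; exists (x ^+ i) => //.
by apply: (subXg (cyc_subgroup x)); exact: cyc_id.
Qed.

Lemma cgen_abelian x : abelian_set (cgen x).
Proof.
apply: closure_abelian; first by case: pG.
exact: cyc_abelian.
Qed.

(** Cosets of open subgroups are clopen and separate points. *)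
Lemma tdlc_periodic_group : periodic_group G.
Proof.
case: pG => hG lG bG cG; split => //.
apply: zero_dimension_totally_disconnected => x y xy.
have [U Uo nU] : exists2 U, open_subgroup U & ~ U (x^-1 * y).
  apply: contrapT => nU; move/eqP: xy; apply; apply/esym/tg_divg_eq1.
  by apply: open_subgroup_eq1 => U Uo; apply: contrapT => nUx; apply: nU; exists U.
exists [set z | U (x^-1 * z)]; split=> //; last by rewrite /= tg_mulVg; exact: (sub1g Uo.1).
split; last by apply: closed_coset; exact: open_subgroup_closed.
by apply: open_comp Uo.2 => z _; exact: tg_mull_cont.
Qed.

End OpenSubgroups.

Lemma periodic_group_tdlc (G : topGroup) : periodic_group G -> tdlc_periodic G.
Proof.
by move=> [[hG lG] tG cG]; split=> // N /(van_dantzig hG lG tG).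
Qed.

(** * Quotients by closed normal subgroups *)

Section Quotient.
Variables (G Q : topGroup) (N : set G) (q : G -> Q).
Hypothesis qN : is_quotient N q.

Lemma quotientM x y : q (x * y) = q x * q y. Proof. by case: qN => ->. Qed.

Lemma quotient_ker x : q x = 1 <-> N x. Proof. by case: qN => _ _ _ _; exact. Qed.

Lemma quotient1 : q 1 = 1.
Proof. by rewrite -(tg_mulKg (q 1) (q 1)) -quotientM tg_mulg1 tg_mulVg. Qed.

Lemma quotientV x : q x^-1 = (q x)^-1.
Proof. by apply: tg_inv_uniq; rewrite -quotientM tg_mulgV quotient1. Qed.

Lemma quotientX x n : q (x ^+ n) = q x ^+ n.
Proof. by elim: n => [|n IH] /=; rewrite ?quotient1 // quotientM IH. Qed.

Lemma quotient_subgroup U : is_subgroup U -> is_subgroup (q @` U).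
Proof.
move=> sU; split; first by exists 1; [exact: sub1g|exact: quotient1].
move=> _ _ [x Ux <-] [y Uy <-]; exists (x * y^-1); first exact: sU.2.
by rewrite quotientM quotientV.
Qed.

Lemma quotient_open_subgroup U : open_subgroup U -> open_subgroup (q @` U).
Proof. by case: qN => _ _ oq _ _ [sU oU]; split; [exact: quotient_subgroup|exact: oq]. Qed.

Lemma quotient_preim_subgroup V : is_subgroup V -> is_subgroup (q @^-1` V).
Proof.
move=> sV; split; first by rewrite /preimage /= quotient1; exact: sub1g.
by move=> x y Vx Vy; rewrite /preimage /= quotientM quotientV; exact: sV.2.
Qed.

Lemma quotient_closed D : closed D -> closed (q @^-1` D).
Proof. by case: qN => _ cq _ _ _; apply: preimage_closed => x _; exact: cq. Qed.

Lemma quotient_compact K : compact K -> compact (q @` K).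
Proof.
case: qN => _ cq _ _ _; apply: continuous_compact; exact: continuous_subspaceT.
Qed.

Lemma quotient_nbhs x M : nbhs x M -> nbhs (q x) (q @` M).
Proof.
case: qN => _ _ oq _ _; rewrite nbhsE => -[O [oO Ox] OM].
apply: (filterS (P := q @` O)); first exact: image_subset.
by apply: open_nbhs_nbhs; split; [exact: oq|exists x].
Qed.

Hypotheses (pG : tdlc_periodic G) (cN : closed N).

(** As [N] is closed, a small open subgroup [V] satisfies that [x * v] is never in [N]. Its image
    [W] is an open subgroup avoiding [a^-1 * b], so the cosets of [a] and [b] modulo [W] are
    disjoint. *)
Lemma quotient_hausdorff : hausdorff_space Q.
Proof.
case: (pG) => hG lG bG cG; case: (qN) => _ cq oq sq _.
rewrite open_hausdorff => a b ab.
have [x qx] := sq (a^-1 * b).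
have nNx : ~ N x.
  by move/quotient_ker; rewrite qx => /tg_divg_eq1 ba; rewrite ba eqxx in ab.
have [V Vo VN] : exists2 V, open_subgroup V & V `<=` [set v | ~ N (x * v)].
  apply: bG; apply: (nbhs_translate (N := ~` N)); apply: open_nbhs_nbhs.
  by split=> //; exact: closed_openC.
have qV := quotient_open_subgroup Vo; have [sW oW] := qV; set W := q @` V in qV sW oW.
have nW : ~ W (a^-1 * b).
  rewrite -qx => -[v Vv qvx]; apply: (VN _ (subVg Vo.1 Vv)).
  by apply/quotient_ker; rewrite quotientM quotientV qvx tg_mulgV.
have oc (c : Q) : open [set z | W (c^-1 * z)] by apply: open_comp oW => z _; exact: tg_mull_cont.
exists ([set z | W (a^-1 * z)], [set z | W (b^-1 * z)]) => /=.
  by rewrite !inE /= !tg_mulVg; split; exact: sub1g.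
split=> //; apply/eqP; rewrite -subset0 => z [/= az bz]; apply: nW.
exact: (sub_coset_trans sW az (sub_coset_sym sW bz)).
Qed.

(** One inclusion is continuity; for the other, the image of the compact [cgen g] is compact, hence
    closed. *)
Lemma quotient_cgen g : q @` cgen g = cgen (q g).
Proof.
case: (pG) => hG lG bG cG; case: (qN) => _ cq oq sq _.
apply/seteqP; split=> [_ [x gx <-]|].
  have : cgen g `<=` q @^-1` cgen (q g).
    apply: cgen_min; last exact: cgen_id.
      by apply: quotient_closed; exact: cgen_closed.
    by apply: quotient_preim_subgroup; exact: cgen_subgroup.
  exact.
apply: cgen_min.
- by apply: (compact_closed quotient_hausdorff); exact: quotient_compact (cG g).
- by apply: quotient_subgroup; exact: cgen_subgroup.
- by exists g => //; exact: cgen_id.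
Qed.

Lemma quotient_tdlc_periodic : tdlc_periodic Q.
Proof.
case: (pG) => hG lG bG cG; case: (qN) => _ cq oq sq _; split.
- exact: quotient_hausdorff.
- move=> z _; have [x <-] := sq z; have [K Kx [cK _]] := lG x I.
  have qK := quotient_compact cK.
  exists (q @` K); last by split=> //; apply: compact_closed => //; exact: quotient_hausdorff.
  have /quotient_nbhs : nbhs x K by move: Kx; rewrite /within /=; apply: filterS => y; exact.
  by rewrite /within /=; apply: filterS.
- move=> M M1; have /bG[U Uo UM] : nbhs 1 (q @^-1` M) by apply: cq; rewrite quotient1.
  exists (q @` U); first exact: quotient_open_subgroup.
  by move=> _ [x Ux <-]; exact: UM.
- by move=> z; have [x <-] := sq z; rewrite -quotient_cgen; exact: quotient_compact.
Qed.

End Quotient.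

(** * Primary components *)

Section PiElements.
Variable G : topGroup.
Implicit Types (x y z g : G) (U S : set G) (pi : nat_pred).

(** In a periodic abelian group and for [p] prime, this is the [p]-primary component when [pi] is
    [p], and the set of elements with vanishing [p]-component when [pi] is the complement of [p]. *)
Definition pi_elements pi : set G :=
  [set x | forall U, open_subgroup U -> exists2 m, pi.-nat m & U (x ^+ m)].

Hypothesis pG : tdlc_periodic G.
Hypothesis abG : abelian_group G.

Lemma mulgC x y : x * y = y * x. Proof. exact: abG. Qed.

Lemma gpowMg x y n : (x * y) ^+ n = x ^+ n * y ^+ n.
Proof. by apply: gpowMn; exact: mulgC. Qed.

Lemma divgM x y z t : (x * y)^-1 * (z * t) = (x^-1 * z) * (y^-1 * t).
Proof.
rewrite tg_invM [_^-1 * _^-1]mulgC -!tg_mulA; congr (_ * _).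
by rewrite tg_mulA [_^-1 * z]mulgC -tg_mulA.
Qed.

Lemma pi_elements_subgroup pi : is_subgroup (pi_elements pi).
Proof.
split=> [U Uo|x y xpi ypi U Uo]; first by exists 1%N; rewrite // gpow1; exact: (sub1g Uo.1).
have [m mpi Ux] := xpi U Uo; have [n npi Uy] := ypi U Uo.
exists (m * n)%N; first by rewrite pnatM mpi.
rewrite gpowMg gpowVn gpowM mulnC gpowM; apply: Uo.1.2; exact: (subXg Uo.1).
Qed.

Lemma pi_elements_closed pi : closed (pi_elements pi).
Proof.
move=> x /(in_closure pG) xpi U Uo; have [s spi Us] := xpi U Uo.
have [m mpi Um] := spi U Uo; exists m => //.
rewrite -(tg_mulKVg s x) gpowMg; apply: (subMg Uo.1) => //; exact: (subXg Uo.1).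
Qed.

Lemma pi_elements_cgen pi x : pi_elements pi x -> cgen x `<=` pi_elements pi.
Proof.
by apply: cgen_min; [exact: pi_elements_closed|exact: pi_elements_subgroup].
Qed.

Lemma pi_elements_coprime pi x : pi_elements pi x -> pi_elements (pi^')%N x -> x = 1.
Proof.
move=> xpi xpi'; apply: open_subgroup_eq1 => // U Uo.
have [m mpi Um] := xpi U Uo; have [n npi Un] := xpi' U Uo.
exact: (coprime_gpow_sub Uo.1 (pnat_coprime mpi npi)).
Qed.

Lemma coprime_gpow_root m n : coprime m n -> (0 < m)%N ->
  exists k l, (k * m = 1 + l * n)%N.
Proof.
by move=> mn m0; have [k l e _] := egcdnP n m0; exists k, l; rewrite e (eqP mn) addnC.
Qed.

(** By Bezout [x] is an [m]-th power modulo each open subgroup, hence a limit of [m]-th powers from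
    [cgen x]; these form a compact, so closed, set. *)
Lemma pi_elements_root pi m x : pi_elements pi x -> (pi^')%N.-nat m ->
  exists2 z, cgen x z & z ^+ m = x.
Proof.
move=> xpi mpi; have [hG _ _ cG] := pG.
pose P := (fun z : G => z ^+ m) @` cgen x.
have cP : closed P.
  apply: compact_closed => //; apply: continuous_compact (cG x).
  by apply: continuous_subspaceT => z; exact: gpow_cont.
suff [z xz zm] : P x by exists z.
apply: cP; apply/(in_closure pG) => U Uo; have [n npi Un] := xpi U Uo.
have [||k [l kl]] := @coprime_gpow_root m n; last 1 first.
- exists (x ^+ k ^+ m).
    by exists (x ^+ k) => //; apply: (subXg (cgen_subgroup x)); exact: cgen_id.
  rewrite -gpowM kl gpowD gpow1 tg_invM tg_mulgKV mulnC gpowM.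
  by apply: (subVg Uo.1); exact: (subXg Uo.1).
- by rewrite coprime_sym; exact: pnat_coprime npi mpi.
- by case/andP: mpi.
Qed.

(* The witness [z] is a limit point of [x ^+ p ^ N`!]: by Euler's theorem,
   this power kills the [p]-part of [x] and fixes the rest modulo any open subgroup. *)
Lemma p_decomposition p x : prime p -> exists y z,
  [/\ x = y * z, cgen x y, cgen x z, pi_elements p y & pi_elements (p^')%N z].
Proof.
move=> pp; have [hG _ _ cG] := pG; have sx := cgen_subgroup x.
have xX n : cgen x (x ^+ n) by apply: (subXg sx); exact: cgen_id.
have [z xz clz] := seq_cluster (cG x) (fun N => xX (p ^ N`!)%N).
exists (x * z^-1), z; split=> //.
- by rewrite tg_mulgKV.
- by apply: sx.2 => //; exact: cgen_id.
- move=> U Uo; have [n n0 Un] := torsion_mod pG x Uo.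
  have [d d0 dE] := order_mod Uo.1 n0 Un.
  set m := (d`_(p^')%N)%N; set k := logn p d.
  have dkm : (d = p ^ k * m)%N by rewrite -p_part partnC.
  have m0 : (0 < m)%N by exact: part_gt0.
  (* So late an index makes [totient m] divide [N!], so that [p ^ N!] is 1 modulo [m]; the factor
     [p ^ k] lifts the congruence to one modulo [d]. *)
  have [N kN UN] := clz U Uo (k + totient m)%N.
  exists (p ^ k)%N; first by rewrite -p_part part_pnat.
  rewrite gpowMg gpowVn mulgC; apply: (sub_coset_trans Uo.1 (coset_gpow Uo.1 _ (mulgC _ _) UN)).
  rewrite -gpowM; apply/(gpow_coset Uo.1 _ _ dE).
  have /dvdnP[t ->] : totient m %| N`!.
    by apply: dvdn_fact; rewrite totient_gt0 m0 (leq_trans _ kN) ?leq_addl.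
  have e1 : (p ^ (t * totient m) = 1 %[mod m])%N.
    rewrite mulnC expnM -modnXm cyclic.Euler_exp_totient ?modnXm ?exp1n //.
    by apply: pnat_coprime (part_pnat (p^')%N d); rewrite pnat_id.
  by rewrite dkm (mulnC (p ^ (t * _))%N) -muln_modr e1 muln_modr muln1.
- move=> U Uo; have [n n0 Un] := torsion_mod pG x Uo.
  have [d d0 dE] := order_mod Uo.1 n0 Un.
  set m := (d`_(p^')%N)%N; set k := logn p d.
  have dkm : (d = p ^ k * m)%N by rewrite -p_part partnC.
  have [N kN UN] := clz U Uo (k + totient m)%N.
  exists m; first exact: part_pnat.
  (* [N] is at least [k], so the exponent is a multiple of [d]; modulo [U] this power agrees with
     [z ^+ m]. *)
  suff Uxm : U (x ^+ (p ^ N`! * m)%N).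
    have := coset_gpow Uo.1 m (mulgC _ _) (sub_coset_sym Uo.1 UN).
    by rewrite -gpowM => /(subMgl Uo.1 _ (subVg Uo.1 Uxm)).
  apply/dE; rewrite dkm dvdn_mul // dvdn_exp2l // (leq_trans _ (fact_geq N)) //.
  by rewrite (leq_trans _ kN) ?leq_addr.
Qed.


(** The powers [x ^+ i] with [i < d], for [d] the order of [x] modulo [U], represent the cosets of
    [U] in [cgen x], and [d] divides a power of [p]. *)
Lemma pi_elements_pro_p p x : prime p -> pi_elements p x -> pro_p p (cgen x).
Proof.
move=> pp xp; have [hG _ _ cG] := pG; split.
- exact: cgen_subgroup.
- exact: cG.
- have [_ tdG _] := tdlc_periodic_group pG.
  move=> y xy; apply/seteqP; split=> [z|_ ->]; last exact: connected_component_refl.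
  by move=> [B [By _ cB] Bz]; rewrite -(tdG y I); exists B.
move=> U sU Ux _ [O [oO UE]].
have [_ _ bG _] := pG.
have [V Vo VO] : exists2 V, open_subgroup V & V `<=` O.
  apply: bG; apply: open_nbhs_nbhs; split=> //.
  by have := sub1g sU; rewrite UE => -[].
have VU z : cgen x z -> V z -> U z by move=> xz Vz; rewrite UE; split=> //; exact: VO.
have xX n : cgen x (x ^+ n) by apply: (subXg (cgen_subgroup x)); exact: cgen_id.
have [n np Vn] := xp V Vo.
have n0 : (0 < n)%N by case/andP: np.
have [d d0 dE] := order_mod sU n0 (VU _ (xX n) Vn).
have /p_natP[k dk] : p.-nat d by apply: pnat_dvd np; apply/dE; exact: VU.
exists k, (mkseq (gpow x) d); split.
- by rewrite size_mkseq.
- by move=> _ /mapP[i _ ->].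
- move=> y xy; have [i Vi] := cgen_coset pG Vo xy.
  exists (x ^+ (i %% d)); first by apply: map_f; rewrite mem_iota ltn_mod.
  apply: (sub_coset_trans sU (y := x ^+ i)).
    by apply/(gpow_coset sU _ _ dE); rewrite modn_mod.
  apply: VU Vi; apply: (subMg (cgen_subgroup x)) => //.
  exact: (subVg (cgen_subgroup x)).
- rewrite size_mkseq => i j id jd ij; rewrite !nth_mkseq //.
  by move/(gpow_coset sU _ _ dE); rewrite !modn_small.
Qed.

(** The given representatives [s] and the powers [x ^+ i] with [i < d] both represent the cosets of
    the trace of [V] on [cgen x]; injections both ways give [d = p ^ k]. *)
Lemma pro_p_pi_elements p x : prime p -> pro_p p (cgen x) -> pi_elements p x.
Proof.
move=> pp [_ _ _ indx] V Vo; have sx := cgen_subgroup x; have sV := Vo.1.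
have xX n : cgen x (x ^+ n) by apply: (subXg sx); exact: cgen_id.
have [n n0 Vn] := torsion_mod pG x Vo; have [d d0 dE] := order_mod sV n0 Vn.
have [||||k [s [ss sx' scov sdisj]]] := indx (cgen x `&` V).
- exact: subgroupI.
- by move=> y [].
- by move=> g u _ [xu Vu]; rewrite /Defs.conjg [u * _]mulgC tg_mulKVg.
- by exists V; split=> //; exact: Vo.2.
exists (p ^ k)%N; first by rewrite pnatX pnat_id.
suff <- : d = (p ^ k)%N by apply/dE.
have nthx (j : 'I_(size s)) : cgen x (nth 1 s j) by apply: sx'; exact: mem_nth.
have /choice[f fP] (j : 'I_(size s)) : exists i : 'I_d, V ((x ^+ i)^-1 * nth 1 s j).
  have [i Vi] := cgen_coset pG Vo (nthx j).
  exists (Ordinal (ltn_pmod i d0)); apply: (sub_coset_trans sV _ Vi).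
  by apply/(gpow_coset sV _ _ dE); rewrite modn_mod.
have /choice[g gP] (i : 'I_d) : exists j : 'I_(size s), V ((nth 1 s j)^-1 * x ^+ i).
  have [y ys [_ Vy]] := scov _ (xX i).
  by exists (Ordinal (etrans (index_mem y s) ys)); rewrite /= nth_index.
have f_inj : injective f.
  move=> j j' fj; apply: contrapT => /eqP/eqP jj'.
  apply: (sdisj j j' _ _ _) => //; first by move=> e; apply: jj'; exact: val_inj.
  split; first by apply: (subMg sx); [exact: (subVg sx)|].
  apply: (sub_coset_trans sV (sub_coset_sym sV (fP j))); rewrite fj; exact: fP.
have g_inj : injective g.
  move=> i i' gi; apply: val_inj; rewrite /= -(modn_small (ltn_ord i)) -(modn_small (ltn_ord i')).
  apply/(gpow_coset sV _ _ dE).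
  apply: (sub_coset_trans sV (sub_coset_sym sV (gP i))); rewrite gi; exact: gP.
have := leq_card _ f_inj; have := leq_card _ g_inj; rewrite !card_ord -ss => ? ?.
by apply/eqP; rewrite eqn_leq; apply/andP.
Qed.

Lemma primaryE p : prime p -> primary p [set: G] = pi_elements p.
Proof.
move=> pp; apply/seteqP; split=> x; first by move=> [_]; exact: pro_p_pi_elements.
by move=> xp; split=> //; exact: pi_elements_pro_p.
Qed.

Lemma pcomp_trivialE p x : prime p -> pcomp_trivial p x <-> pi_elements (p^')%N x.
Proof.
move=> pp; split=> [xp|xp y xy /(pro_p_pi_elements pp) yp]; last first.
  exact: pi_elements_coprime yp (pi_elements_cgen xp xy).
have [y [z [xE xy xz yp zp]]] := p_decomposition x pp.
by rewrite xE (xp y xy (pi_elements_pro_p pp yp)) tg_mul1g.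
Qed.

(** As an intersection of closed subgroups, the divisible part is itself a closed subgroup. *)
Lemma div_partE : @div_part G =
  \bigcap_(p in [set p | prime p /\ ~ divisible (pi_elements p)]) pi_elements (p^')%N.
Proof.
apply/seteqP; split=> x H p.
  by move=> [pp nd]; apply/(pcomp_trivialE _ pp)/H => //; rewrite primaryE.
by move=> pp nd; apply/(pcomp_trivialE _ pp)/H; split=> //; rewrite -primaryE.
Qed.

Lemma div_part_subgroup : is_subgroup (@div_part G).
Proof.
rewrite div_partE; split=> [p _|x y Hx Hy p Hp]; first exact: sub1g (pi_elements_subgroup _).
by apply: (pi_elements_subgroup _).2; [exact: Hx|exact: Hy].
Qed.

Lemma div_part_closed : closed (@div_part G).
Proof. by rewrite div_partE; apply: closed_bigI => p _; exact: pi_elements_closed. Qed.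

Lemma div_part_cgen x : div_part x -> cgen x `<=` @div_part G.
Proof. by apply: cgen_min; [exact: div_part_closed|exact: div_part_subgroup]. Qed.

Lemma pi_elements_sub (pi rho : nat_pred) :
  {subset pi <= rho} -> pi_elements pi `<=` pi_elements rho.
Proof.
move=> sub x H U /H[m mpi Um]; exists m => //.
by apply: sub_in_pnat mpi => r _; exact: sub.
Qed.

Lemma divisible_primary_div_part p : prime p -> divisible (pi_elements p) ->
  pi_elements p `<=` @div_part G.
Proof.
move=> pp dp x xp; rewrite div_partE => r [rp ndr]; apply: pi_elements_sub xp => l.
rewrite !inE => /eqP ->; apply/eqP => pr; apply: ndr; by rewrite -pr.
Qed.

(** It suffices to take [p]-th roots for [p] prime. If the [p]-component of [G] is not divisible,
    [y] is prime to [p] and has a root in [cgen y]. Otherwise split [y] into a [p]-part, with a root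
    by divisibility, and a part prime to [p]. *)
Lemma div_part_divisible : divisible (@div_part G).
Proof.
have prime_root p y : prime p -> div_part y -> exists2 z, div_part z & z ^+ p = y :> G.
  move=> pp Dy.
  have root z : pi_elements (p^')%N z -> exists2 w, cgen z w & w ^+ p = z.
    move=> zp; apply: (pi_elements_root zp); rewrite pnatNK; exact: pnat_id.
  have [dp|ndp] := pselect (divisible (pi_elements p)); last first.
    have [|z yz zy] := root y; first by move: Dy; rewrite div_partE; exact.
    by exists z => //; exact: (div_part_cgen Dy).
  have [a [b [yE ya yb ap bp]]] := p_decomposition y pp.
  have [c cp ca] := dp a ap p (prime_gt0 pp).
  have [e be eb] := root b bp.
  exists (c * e); last by rewrite gpowMg ca eb.
  apply: (subMg div_part_subgroup); first exact: divisible_primary_div_part cp.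
  by apply: (div_part_cgen _ be); exact: (div_part_cgen Dy).
move=> y Dy n; elim/ltn_ind: n y Dy => n IH y Dy n0.
have [n1|n1] := leqP n 1.
  by exists y => //; rewrite (_ : n = 1%N) ?gpow1 //; case: n n0 n1 {IH} => [|[]].
have pp := pdiv_prime n1; have [m nE] := dvdnP (pdiv_dvd n).
have [z Dz zy] := prime_root _ y pp Dy.
have m0 : (0 < m)%N by case: m nE n0 => // ->.
have mn : (m < n)%N by rewrite [ltnRHS]nE -{1}(muln1 m) ltn_pmul2l // prime_gt1.
have [w Dw wz] := IH m mn z Dz m0.
by exists w => //; rewrite {1}nE gpowM wz.
Qed.

End PiElements.

(** * Procyclic groups *)

Section Primary.
Variable G : topGroup.
Implicit Types (x y z g : G) (U : set G).
Hypothesis pG : tdlc_periodic G.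
Hypothesis abG : abelian_group G.
Variable p : nat.
Hypothesis pp : prime p.

Lemma gpow_cgen x n : cgen x (x ^+ n).
Proof. by apply: (subXg (cgen_subgroup x)); exact: cgen_id. Qed.

(** Roots of order prime to [p] always exist among [p]-elements, so divisibility can only fail at
    [p]-th roots. *)
Lemma not_divisible_root : ~ divisible (pi_elements (G := G) p) ->
  exists2 y, pi_elements p y & forall z, pi_elements p z -> z ^+ p <> y.
Proof.
move=> ndiv; apply: contrapT => nroot; apply: ndiv => y yp n n0.
have root z : pi_elements p z -> exists2 w, pi_elements p w & w ^+ p = z.
  move=> zp; apply: contrapT => nw; apply: nroot; exists z => // w wp wz; apply: nw.
  by exists w.
have rootX k : exists2 w, pi_elements p w & w ^+ (p ^ k) = y.
  elim: k => [|k [w wp wy]]; first by exists y; rewrite ?expn0 ?gpow1.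
  by have [v vp vw] := root w wp; exists v => //; rewrite expnS gpowM vw.
have [w wp wy] := rootX (logn p n).
have [v vw vE] := pi_elements_root pG wp (part_pnat (p^')%N n).
exists v; first exact: (pi_elements_cgen pG abG wp).
by rewrite -(partnC p n0) p_part mulnC gpowM vE.
Qed.

(** A Frattini argument: the [p]-th powers in [cgen g] form a closed set, so [y] avoids them modulo
    some open [U0]. Modulo smaller open subgroups [y] is thus [g ^+ i] with [i] prime to [p], and
    Bezout recovers [g] as a power of [y]. *)
Lemma cgen_no_root y g : pi_elements p g -> cgen g y ->
  (forall z, pi_elements p z -> z ^+ p <> y) -> cgen y g.
Proof.
move=> gp gy nroot; have [hG _ _ cG] := pG.
pose P := (fun z : G => z ^+ p) @` cgen g.
have cP : closed P.
  apply: compact_closed => //; apply: continuous_compact (cG g).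
  by apply: continuous_subspaceT => z; exact: gpow_cont.
have [U0 U0o nU0] : exists2 U, open_subgroup U & forall s, P s -> ~ U (s^-1 * y).
  apply: contrapT => nU.
  have [z zg zy] : P y.
    apply: cP; apply/(in_closure pG) => U Uo; apply: contrapT => nPs; apply: nU.
    by exists U => // s Ps Us; apply: nPs; exists s.
  exact: (nroot z (pi_elements_cgen pG abG gp zg)).
apply: (in_cgen pG) => U Uo; have UU0 := open_subgroupI Uo U0o.
have [i [Ui U0i]] := cgen_coset pG UU0 gy.
have [n np Un] := gp U Uo.
have pi : coprime i n.
  rewrite coprime_sym; apply: pnat_coprime np _.
  rewrite p'natE //; apply/negP => /dvdnP[j ij]; apply: (nU0 (g ^+ i)) => //.
  by exists (g ^+ j); [exact: gpow_cgen|rewrite ij gpowM].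
(* Natural Bezout coefficients need [i] positive; [i = 0] would put [y] in the coset of the [p]-th
   power 1. *)
case: (posnP i) => [i0|i0].
  case: (nU0 1) => //; last by rewrite -[1]/(g ^+ 0) -i0.
  by exists 1; [exact: sub1g (cgen_subgroup g)|exact: gpow1g].
have [k [l kl]] := coprime_gpow_root pi i0.
exists k; apply: (sub_coset_trans Uo.1 (y := g ^+ i ^+ k)).
  by apply: (coset_gpow Uo.1); [exact: abG|exact: (sub_coset_sym Uo.1)].
rewrite -gpowM mulnC kl gpowD gpow1 tg_invM tg_mulgKV mulnC gpowM.
by apply: (subVg Uo.1); exact: (subXg Uo.1).
Qed.

(** Any [p]-element [b] lies with [y] in one [cgen g], and [y], having no [p]-th root, already
    generates it. *)
Lemma not_divisible_procyclic : inductively_monothetic G ->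
  ~ divisible (pi_elements (G := G) p) ->
  exists2 y, pi_elements (G := G) p y & pi_elements p = cgen y.
Proof.
move=> imG /not_divisible_root[y yp nroot]; exists y => //.
apply/seteqP; split=> [b bp|]; last exact: pi_elements_cgen yp.
have [g gE] : exists g, closure (gen [set b; y]) = cgen g by apply: imG; exact: finite_set2.
have gp : pi_elements p g.
  have : cgen g `<=` pi_elements p.
    rewrite -gE; apply: closure_min; first exact: pi_elements_closed.
    by apply: gen_min; [exact: pi_elements_subgroup|move=> _ [] ->].
  by apply; exact: cgen_id.
have gS z : [set b; y] z -> cgen g z.
  by move=> bz; rewrite -gE; apply: subset_closure; exact: sub_gen.
have yg : cgen y g by apply: cgen_no_root => //; apply: gS; right.
have : cgen g `<=` cgen y by apply: cgen_min; [exact: cgen_closed|exact: cgen_subgroup|].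
by apply; apply: gS; left.
Qed.

Variable y : G.
Hypothesis yp : pi_elements p y.

(** [y] raised to the [p]-part of [n] is both a [p]-element and prime to [p], hence 1; the finite
    set of powers is then closed. *)
Lemma finite_order_cyclic n : (0 < n)%N -> y ^+ n = 1 -> finite_cyclic_p p (cgen y).
Proof.
move=> n0 yn; have [hG _ _ _] := pG.
have yk : y ^+ (p ^ logn p n) = 1.
  apply: (pi_elements_coprime pG (pi := p)); first exact: (subXg (pi_elements_subgroup abG _)).
  move=> U Uo; exists (n`_(p^'))%N; first exact: part_pnat.
  by rewrite -p_part -gpowM partnC // yn; exact: (sub1g Uo.1).
set k := logn p n in yk; exists y, k; split=> //; apply/seteqP; split; last first.
  by move=> _ [i _ <-]; exact: gpow_cgen.
apply: closure_min.
  apply: compact_closed => //; apply: finite_compact; apply: finite_image; exact: finite_II.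
move=> z /(cyc_coset (@subgroup1 G) (n := (p ^ k)%N)).
rewrite expn_gt0 prime_gt0 //= => /(_ isT yk)[i ik /tg_divg_eq1 ->].
by exists i.
Qed.

(** * Procyclic pro-p groups of infinite order are the p-adic integers *)

Section InfiniteOrder.
Hypothesis y_inf : forall n, (0 < n)%N -> y ^+ n <> 1.

(** The counterpart of the ideal generated by [p ^ n] in the [p]-adic integers. *)
Let B n := cgen (y ^+ (p ^ n)).
Let sB n : is_subgroup (B n) := cgen_subgroup _.
Let cB n : closed (B n) := @cgen_closed _ _.

Let B_anti m n : (m <= n)%N -> B n `<=` B m.
Proof.
move=> mn; apply: cgen_min; [exact: cB|exact: sB|].
rewrite -(subnKC mn) expnD gpowM; exact: gpow_cgen.
Qed.

Let B_small U : open_subgroup U -> exists n, B n `<=` U.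
Proof.
move=> Uo; have [m /p_natP[n ->] Um] := yp Uo; exists n.
by apply: cgen_min => //; [exact: open_subgroup_closed|exact: Uo.1].
Qed.

Let B_separated x : (forall n, B n x) -> x = 1.
Proof.
by move=> Bx; apply: (open_subgroup_eq1 pG) => U /B_small[n BU]; exact: BU.
Qed.

(** The order of [y] modulo [B n] is some [p ^ j]. If [j < n], then [w = y ^+ (p ^ j)] lies in
    [cgen (w ^+ p)], so modulo each open subgroup a power of [w] with exponent [p * i - 1], prime to
    [p], vanishes. Hence [w = 1], against infinite order. *)
Let B_power n m : B n (y ^+ m) <-> p ^ n %| m.
Proof.
have Bn : B n (y ^+ (p ^ n)) by exact: cgen_id.
have pn0 : (0 < p ^ n)%N by rewrite expn_gt0 prime_gt0.
have [d d0 dE] := order_mod (sB n) pn0 Bn.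
rewrite dE; suff -> : d = (p ^ n)%N by [].
have /(dvdn_pfactor _ _ pp)[j jn dj] : d %| p ^ n by apply/dE.
rewrite dj; congr (_ ^ _)%N; apply/eqP; rewrite eqn_leq jn leqNgt; apply/negP => jn'.
pose w := y ^+ (p ^ j).
have wp : pi_elements p w by exact: (subXg (pi_elements_subgroup abG _)).
suff w1 : w = 1 by apply: (y_inf _ w1); rewrite expn_gt0 prime_gt0.
have Bw : cgen (w ^+ p) w.
  rewrite -gpowM -expnSr; apply: (B_anti jn'); apply/dE; by rewrite dj.
apply: (open_subgroup_eq1 pG) => U Uo; have [i Ui] := cgen_coset pG Uo Bw.
have [h hp Uh] := wp U Uo.
have [i0|i0] := posnP i; first by move: Ui; rewrite i0 /= tg_inv1 tg_mul1g.
have pi0 : (0 < p * i)%N by rewrite muln_gt0 prime_gt0.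
apply: (coprime_gpow_sub Uo.1 (m := (p * i).-1) (n := h)) => //.
  have /p_natP[l ->] := hp; apply: coprimeXr.
  by have := coprimePn pi0; rewrite coprimeMr => /andP[].
have := sub_coset_sym Uo.1 Ui.
by rewrite -gpowM -(prednK pi0) /= tg_mulKg.
Qed.

Let B_coset n i j : B n ((y ^+ i)^-1 * y ^+ j) <-> i = j %[mod p ^ n].
Proof. exact: (gpow_coset (sB n) i j (B_power n)). Qed.

(** Finitely many closed cosets of [B n] cover [cyc y], hence its closure. *)
Let B_cover n b : cgen y b -> exists2 i, (i < p ^ n)%N & B n ((y ^+ i)^-1 * b).
Proof.
pose C := \bigcup_(i in `I_(p ^ n)) [set b | B n ((y ^+ i)^-1 * b)].
have cC : closed C.
  apply: closed_bigcup; first exact: finite_II.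
  by move=> i _; apply: closed_coset; exact: cB.
suff yC : cgen y `<=` C by move=> /yC[i]; exists i.
apply: closure_min => // z yz.
have [||i] := cyc_coset (sB n) (n := (p ^ n)%N) _ _ yz.
- by rewrite expn_gt0 prime_gt0.
- exact: cgen_id.
by exists i.
Qed.

(* [lim_spec x] is the singleton of the limit of [y ^+ x n], for [x] a [p]-adic integer. *)
Let lim_spec (x : nat -> nat) : set G := [set b | forall n, B n ((y ^+ x n)^-1 * b)].
(** The default [1] is never taken at a [p]-adic integer, by [phiP]. *)
Let phi (x : nat -> nat) : G := xget 1 (lim_spec x).

Let lim_unique (x : nat -> nat) b c : lim_spec x b -> lim_spec x c -> b = c.
Proof.
move=> xb xc; apply/esym/tg_divg_eq1/B_separated => n.
exact: (sub_coset_trans (sB n) (sub_coset_sym (sB n) (xb n)) (xc n)).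
Qed.

Let phiE (x : nat -> nat) b : lim_spec x b -> phi x = b.
Proof. by move=> xb; apply: xget_unique => // c /lim_unique; apply. Qed.

Let padic_mod (x : nat -> nat) m n : padic p x -> (n <= m)%N -> x n = x m %[mod p ^ n].
Proof.
move=> px nm; rewrite -(subnKC nm); elim: (m - n)%N => [|k IH]; first by rewrite addn0.
rewrite IH addnS -(px (n + k)%N).2 modn_dvdm //.
by apply: dvdn_exp2l; exact: leq_addr.
Qed.

(** Any cluster point of [y ^+ x n] works: from index [n] on, the exponents agree modulo [p ^ n], so
    the sequence stays in one closed coset of [B n]. *)
Let phiP (x : nat -> nat) : padic p x -> lim_spec x (phi x).
Proof.
move=> px; apply: xgetPex; have [_ _ _ cG] := pG.
have [b _ bx] := seq_cluster (cG y) (fun n => @gpow_cgen y (x n)).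
exists b => n; apply: (cB (n := n)); apply/(in_closure pG) => U Uo.
have [m nm Um] := bx U Uo n.
exists ((y ^+ x n)^-1 * y ^+ x m); first by apply/B_coset; exact: padic_mod.
rewrite tg_invM tg_invK -tg_mulA tg_mulKVg; exact: (sub_coset_sym Uo.1).
Qed.

Let phi_cgen (x : nat -> nat) : padic p x -> cgen y (phi x).
Proof.
move=> px; have := phiP px (n := 0%N); rewrite /B gpow1.
by move/(subMgl (cgen_subgroup y) _ (subVg (cgen_subgroup y) (@gpow_cgen y _))).
Qed.

Let phi_eq_mod (x x' : nat -> nat) n : padic p x -> padic p x' ->
  B n ((phi x)^-1 * phi x') -> x n = x' n.
Proof.
move=> px px' Bn; have : x n = x' n %[mod p ^ n].
  apply/B_coset; apply: (sub_coset_trans (sB n) (phiP px (n := n))).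
  exact: (sub_coset_trans (sB n) Bn (sub_coset_sym (sB n) (phiP px' (n := n)))).
by rewrite !modn_small ?(px n).1 ?(px' n).1.
Qed.

(** [B n] is relatively open in [cgen y], because its finitely many other cosets have a closed union
    [C] avoiding 1. *)
Let B_nbhs (g : G) n : nbhs g [set z | cgen y (g^-1 * z) -> B n (g^-1 * z)].
Proof.
pose C := \bigcup_(i in [set i | (0 < i < p ^ n)%N]) [set b | B n ((y ^+ i)^-1 * b)].
have cC : closed C.
  apply: closed_bigcup; first by apply: sub_finite_set (finite_II (p ^ n)%N) => i /andP[].
  by move=> i _; apply: closed_coset; exact: cB.
have nC : nbhs 1 (~` C).
  apply: open_nbhs_nbhs; split; first exact: closed_openC.
  move=> [i /= /andP[i0 ilt]]; rewrite tg_mulg1 => /(subVg (sB n)); rewrite tg_invK.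
  by move/B_power; rewrite gtnNdvd.
apply: filterS (nbhs_coset g nC) => z /= nCz yz.
have [i ilt Bi] := B_cover n yz; have [i0|i0] := posnP i.
  by move: Bi; rewrite i0 /= tg_inv1 tg_mul1g.
by case: nCz; exists i => //=; rewrite i0.
Qed.

Lemma infinite_order_iso_Zp : iso_Zp p (cgen y).
Proof.
exists phi; split.
- exact: phi_cgen.
(* The [n]-th term of the [p]-adic integer of [b] is the index of the coset of [B n] containing
   [b]. *)
- move=> b yb; have /choice[x xP] n : exists i, (i < p ^ n)%N /\ B n ((y ^+ i)^-1 * b).
    by have [i ? ?] := B_cover n yb; exists i.
  exists x; last by apply: phiE => n; case: (xP n).
  move=> n; split; first by case: (xP n).
  have Bn : B n ((y ^+ x n.+1)^-1 * b) by apply: (B_anti (leqnSn n)); case: (xP n.+1).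
  have /B_coset -> := sub_coset_trans (sB n) Bn (sub_coset_sym (sB n) (xP n).2).
  by rewrite modn_small //; case: (xP n).
- move=> x x' px px' xx'; apply/funext => n; apply: phi_eq_mod => //.
  by rewrite xx' tg_mulVg; exact: sub1g.
- move=> x x' px px'; apply: phiE => n.
  have Bs : B n ((y ^+ zp_add p x x' n)^-1 * (y ^+ x n * y ^+ x' n)).
    by rewrite -gpowD; apply/B_coset; rewrite /zp_add modn_mod.
  apply: (sub_coset_trans (sB n) Bs); rewrite divgM //.
  by apply: (subMg (sB n)); exact: phiP.
(* Continuity of [phi] rests on [B_small], that of its inverse on [B_nbhs]. *)
- split=> x px.
    move=> V xV; have [_ _ bG _] := pG.
    have [U /B_small[n BU] UV] := bG _ (nbhs_translate xV).
    exists n => x' px' x'n; rewrite -(tg_mulKVg (phi x) (phi x')); apply: UV; apply: BU.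
    apply: (sub_coset_trans (sB n) (sub_coset_sym (sB n) (phiP px (n := n)))).
    by rewrite -x'n; exact: phiP.
  move=> n; exists [set z | cgen y ((phi x)^-1 * z) -> B n ((phi x)^-1 * z)]; first exact: B_nbhs.
  move=> x' px' /= Vx'; apply/esym/phi_eq_mod => //; apply: Vx'.
  have sy := cgen_subgroup y; apply: (subMg sy); last exact: phi_cgen.
  by apply: (subVg sy); exact: phi_cgen.
Qed.

End InfiniteOrder.

Lemma procyclic_classification : finite_cyclic_p p (cgen y) \/ iso_Zp p (cgen y).
Proof.
have [[n n0 yn]|y_inf] := pselect (exists2 n, (0 < n)%N & y ^+ n = 1).
  by left; exact: (finite_order_cyclic n0).
by right; apply: infinite_order_iso_Zp => n n0 yn; apply: y_inf; exists n.
Qed.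

End Primary.

(** * Near abelian groups *)

Section QuotientPrimary.
Variables (Q R : topGroup) (D : set Q) (r : Q -> R).
Hypotheses (pQ : tdlc_periodic Q) (abQ : abelian_group Q) (cD : closed D).
Hypothesis rD : is_quotient D r.

Lemma quotient_pi_elements pi x : pi_elements pi x -> pi_elements pi (r x).
Proof.
move=> xpi U [sU oU]; have [_ cr _ _ _] := rD.
have [|m mpi Um] := xpi (r @^-1` U).
  split; first exact: (quotient_preim_subgroup rD).
  by apply: open_comp oU => z _; exact: cr.
by exists m => //; rewrite -(quotientX rD).
Qed.

Lemma quotient_abelian : abelian_group R.
Proof.
have [_ _ _ sr _] := rD; move=> a b _ _.
have [x <-] := sr a; have [y <-] := sr b.
by rewrite -!(quotientM rD) (abQ (x := x) (y := y)).
Qed.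

(** Lift a [p]-element [a] to [x] and split [x = y * z]. Then [r z] is prime to [p], and a
    [p]-element as the quotient of [a] by [r y]; so it is 1. *)
Lemma quotient_p_elements p : prime p -> pi_elements p = r @` pi_elements p.
Proof.
move=> pp; have pR := quotient_tdlc_periodic rD pQ cD.
have abR := quotient_abelian.
apply/seteqP; split=> [a ap|_ [x xp <-]]; last exact: quotient_pi_elements.
have [_ _ _ sr _] := rD; have [x xa] := sr a.
have [y [z [xE _ _ yp zp]]] := p_decomposition pQ abQ x pp.
have rz : r z = 1.
  apply: (pi_elements_coprime pR (pi := p)); last exact: quotient_pi_elements.
  have -> : r z = (r y)^-1 * a by rewrite -xa xE (quotientM rD) tg_mulKg.
  apply: (subMg (pi_elements_subgroup abR _)) => //.
  by apply: (subVg (pi_elements_subgroup abR _)); exact: quotient_pi_elements.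
by exists y => //; rewrite -xa xE (quotientM rD) rz tg_mulg1.
Qed.

Lemma quotient_div_part_Pi_procyclic : inductively_monothetic Q -> D = @div_part Q ->
  Pi_procyclic R.
Proof.
move=> imQ DE; have pR := quotient_tdlc_periodic rD pQ cD.
have abR := quotient_abelian.
split=> //; first exact: tdlc_periodic_group.
move=> p pp; rewrite primaryE // quotient_p_elements //.
have [dp|ndp] := pselect (divisible (pi_elements (G := Q) p)); last first.
  have [y yp ->] := not_divisible_procyclic pQ abQ pp imQ ndp.
  rewrite (quotient_cgen rD pQ cD); apply: procyclic_classification => //.
  exact: quotient_pi_elements.
(* Here the [p]-elements of [Q] lie in [D], so their image is the trivial group, of order
   [p ^ 0]. *)
left; exists 1, 0%N; rewrite gpow1; split=> //; apply/seteqP; split=> a.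
  move=> [x xp <-]; exists 0%N => //=; apply/esym/(quotient_ker rD); rewrite DE.
  exact: (divisible_primary_div_part pQ abQ pp dp).
move=> [i _ <-]; exists 1; first exact: (sub1g (pi_elements_subgroup abQ _)).
by rewrite gpow1g (quotient1 rD).
Qed.

End QuotientPrimary.

Section NearAbelian.
Variables (G Q : topGroup) (A : set G) (q : G -> Q).
Hypotheses (perG : periodic_group G) (naG : near_abelian A q).

Let pG : tdlc_periodic G := periodic_group_tdlc perG.
Let cA : closed A. Proof. by case: naG => _ []. Qed.
Let sA : is_subgroup A. Proof. by case: naG => _ []. Qed.
Let abA : abelian_set A. Proof. by case: naG => _ []. Qed.
Let qA : is_quotient A q. Proof. by case: naG. Qed.
Let abQ : abelian_group Q. Proof. by case: naG => _ _ _ []. Qed.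
Let imQ : inductively_monothetic Q. Proof. by case: naG => _ _ _ []. Qed.
Let pQ : tdlc_periodic Q := quotient_tdlc_periodic qA pG cA.

Let conj_stable B h x : closed B -> is_subgroup B -> B `<=` A -> B x -> B (conjg x h).
Proof. by case: naG => _ _ _ _ nB cB sB BA Bx; apply: (nB B cB sB BA).2. Qed.

Let q_eq x y : q x = q y -> A (x^-1 * y).
Proof.
by move=> xy; apply/(quotient_ker qA); rewrite (quotientM qA) (quotientV qA) xy tg_mulVg.
Qed.

(** * Conjugation on a finite cyclic quotient of [cgen a] *)

Section ConjugationExponent.
Variables (a : G) (U : set G) (h : G) (d i : nat).
Hypotheses (Aa : A a) (sU : is_subgroup U) (Ua : U `<=` cgen a).
Hypothesis U_conj : forall x g, U x -> U (conjg x g).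
Hypothesis a_conj : cgen a (conjg a h).
Hypothesis dE : forall m, U (a ^+ m) <-> d %| m.
Hypothesis iE : U ((a ^+ i)^-1 * conjg a h).

Let aC n : a ^+ n * conjg a h = conjg a h * a ^+ n.
Proof. by apply: (@cgen_abelian _ pG a) => //; exact: gpow_cgen. Qed.

(** Conjugation by [h] acts modulo [U] as the [i]-th power map and is injective. With [c] the gcd of
    [i] and [d], it sends [a ^+ (d %/ c)] into [U], so [d] divides [d %/ c]. *)
Lemma conj_exponent_coprime : (0 < d)%N -> coprime i d.
Proof.
move=> d0; set c := gcdn i d.
have c0 : (0 < c)%N by rewrite gcdn_gt0 d0 orbT.
suff dc : d %| d %/ c.
  have [c1|c1] := ltnP 1 c; last by rewrite /coprime eqn_leq c1.
  have dc0 : (0 < d %/ c)%N by rewrite divn_gt0 // dvdn_leq ?dvdn_gcdr.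
  by have := dvdn_leq dc0 dc; rewrite leqNgt ltn_Pdiv.
apply/dE; rewrite -(conjgK (a ^+ _) h); apply: U_conj; rewrite gpow_conjg.
have := coset_gpow sU (d %/ c) (aC i) iE; rewrite -gpowM.
apply: (subMgl sU _ _).1; apply: (subVg sU); apply/dE.
by rewrite muln_divA ?dvdn_gcdr // -divn_mulAC ?dvdn_gcdl // dvdn_mull.
Qed.

Lemma conj_exponent_iter k : U ((a ^+ (i ^ k))^-1 * conjg a (h ^+ k)).
Proof.
elim: k => [|k IH]; first by rewrite gpow1 conjg1 tg_mulVg; exact: sub1g.
have := U_conj h IH; rewrite conjMg conjVg gpow_conjg -conjgM.
apply: (sub_coset_trans sU); rewrite expnS gpowM; exact: coset_gpow.
Qed.

End ConjugationExponent.

(* The conjugation action of [G] on the finite cyclic group [cl<a> / U] has exponent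
   dividing [totient], hence is trivial on elements that are divisible modulo [A]. *)
Lemma div_part_centralises : q @^-1` (@div_part Q) `<=` centraliser A.
Proof.
move=> g Dg a Aa.
suff ga : conjg a g = a by rewrite -{2}ga /Defs.conjg -!tg_mulA tg_mulVg tg_mulg1.
apply/tg_divg_eq1; apply: (open_subgroup_eq1 pG) => V Vo.
(* A closed subgroup of [A], hence normal in [G]: conjugation acts on [cgen a] modulo [U]. *)
pose U := cgen a `&` V.
have aA : cgen a `<=` A := cgen_min cA sA Aa.
have sU : is_subgroup U by apply: subgroupI; [exact: cgen_subgroup|exact: Vo.1].
have cU : closed U by apply: closedI; [exact: cgen_closed|exact: open_subgroup_closed].
have Ua : U `<=` cgen a by move=> x [].
have UA : U `<=` A by move=> x /Ua/aA.
have U_conj x h : U x -> U (conjg x h) by exact: (@conj_stable U).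
have a_conj h : cgen a (conjg a h).
  apply: (@conj_stable (cgen a)) => //; [|exact: cgen_subgroup|exact: cgen_id].
  exact: cgen_closed.
have [n n0 Vn] := torsion_mod pG a Vo.
have Un : U (a ^+ n) by split=> //; exact: gpow_cgen.
have [d d0 dE] := order_mod sU n0 Un.
have [_ _ _ sq _] := qA.
have e0 : (0 < totient d)%N by rewrite totient_gt0.
have [z Dz zg] := div_part_divisible pQ abQ Dg e0.
have [h hz] := sq z.
have [i Vi] := cgen_coset pG Vo (a_conj h).
have iE : U ((a ^+ i)^-1 * conjg a h).
  split=> //; apply: (subMg (cgen_subgroup a)) => //.
  by apply: (subVg (cgen_subgroup a)); exact: gpow_cgen.
(* [g] and [h ^+ totient d] differ by an element of the abelian [A], so they conjugate [a] alike. *)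
have hg : A ((h ^+ totient d)^-1 * g) by apply: q_eq; rewrite (quotientX qA) hz.
rewrite -(tg_mulKVg (h ^+ totient d) g) conjgM.
rewrite [in X in conjg X _]/Defs.conjg tg_mulA (abA hg Aa) -tg_mulA tg_mulgV tg_mulg1.
suff [] : U (a^-1 * conjg a (h ^+ totient d)) by [].
(* Modulo [U], conjugation by [h ^+ totient d] raises [a] to the exponent [i ^ totient d], which is
   1 modulo [d] by Euler's theorem. *)
have := conj_exponent_iter sU U_conj (a_conj h) iE (totient d).
apply: (sub_coset_trans sU); rewrite -{1}(gpow1 a); apply/(gpow_coset sU _ _ dE).
apply/esym/cyclic.Euler_exp_totient; exact: conj_exponent_coprime iE d0.
Qed.

Lemma base_sub_div_part : A `<=` q @^-1` (@div_part Q).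
Proof.
move=> a /(quotient_ker qA) qa; rewrite /preimage /= qa.
exact: (sub1g (div_part_subgroup pQ abQ)).
Qed.

Lemma div_part_preim_normal : normal_sub (q @^-1` (@div_part Q)).
Proof.
split; first by apply: (quotient_preim_subgroup qA); exact: div_part_subgroup.
move=> g x; rewrite /preimage /= /Defs.conjg !(quotientM qA) (quotientV qA).
by rewrite [q x * _](mulgC abQ) tg_mulKVg.
Qed.

(* Two elements of the preimage of [D] lie in the closure of [<g>A] for some [g]
   centralising [A]. *)
Lemma div_part_preim_abelian : abelian_set (q @^-1` (@div_part Q)).
Proof.
move=> x y Dx Dy; have [hG _ _ _] := pG.
have [z zE] : exists z, closure (gen [set q x; q y]) = cgen z.
  by apply: imQ; exact: finite_set2.
have sD := div_part_subgroup pQ abQ; have cD := div_part_closed pQ abQ.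
have zD : cgen z `<=` @div_part Q.
  by rewrite -zE; apply: closure_min => //; apply: gen_min => // _ [] ->.
have [_ _ _ sq _] := qA; have [g gz] := sq z.
have Dg : div_part (q g) by rewrite gz; apply: zD; exact: cgen_id.
(* Above the dense subgroup [cyc z], each element is an integral power of [g] times an element of
   [A], which [g] centralises; commutativity then extends to the closure. *)
pose T := q @^-1` cyc z.
have TD : T `<=` q @^-1` (@div_part Q) by move=> t Tt; apply: zD; exact: subset_closure.
have T_dec t : T t -> exists c b, [/\ t = c * b, cyc g c & A b].
  move=> /cycE[m [n tE]]; exists (g ^+ m * (g ^+ n)^-1), ((g ^+ m * (g ^+ n)^-1)^-1 * t).
  split; [by rewrite tg_mulKVg|by apply/cycE; exists m, n|].
  by apply: q_eq; rewrite (quotientM qA) (quotientV qA) !(quotientX qA) gz tE.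
have gT t : T t -> g * t = t * g.
  move=> /T_dec[c [b [-> gc Ab]]]; apply: (subMg (commute_subgroup g)).
    by apply: (@cyc_abelian _ g) => //; exact: cyc_id.
  exact: div_part_centralises Dg _ Ab.
have abT : abelian_set T.
  move=> t t' Tt /T_dec[c [b [-> gc Ab]]]; apply: (subMg (commute_subgroup t)).
    by apply: (cyc_sub (commute_subgroup t)) gc; rewrite /= gT.
  exact: div_part_centralises (TD _ Tt) _ Ab.
(* Since [q] is open, whatever lies above the closure of [cyc z] lies in the closure of [T]. *)
have TS u : cgen z (q u) -> closure T u.
  move=> zu N /(quotient_nbhs qA)/zu [w [zw [v Nv vw]]]; exists v; split=> //.
  by rewrite /T /preimage /= vw.
apply: (closure_abelian hG abT); apply: TS; rewrite -zE.
  by apply: subset_closure; apply: sub_gen; left.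
by apply: subset_closure; apply: sub_gen; right.
Qed.

(** Third isomorphism theorem: [R] is also the quotient of [Q] by its divisible part. The induced
    map is [r \o s] for a set-theoretic section [s] of [q], and [rs] says that the choice of [s]
    does not matter. *)
Lemma quotient_div_part_preim (R : topGroup) (r : G -> R) :
  is_quotient (q @^-1` (@div_part Q)) r -> Pi_procyclic R.
Proof.
move=> rD; have [_ cq oq sq _] := qA; have [_ cr or sr _] := rD.
have cD := div_part_closed pQ abQ.
have [s sE] := choice sq.
have rs g : r (s (q g)) = r g.
  apply/esym/tg_divg_eq1; rewrite -(quotientV rD) -(quotientM rD).
  by apply/(quotient_ker rD)/base_sub_div_part/q_eq; rewrite sE.
have qK (O : set Q) : q @` (q @^-1` O) = O.
  by apply/seteqP; split=> [_ [x Ox <-]//|z Oz]; exists (s z) => //; rewrite /preimage /= sE.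
suff rsD : is_quotient (@div_part Q) (r \o s).
  exact: quotient_div_part_Pi_procyclic pQ abQ cD rsD imQ (erefl _).
split.
- move=> x y; rewrite /= -(quotientM rD) -(rs (s x * s y)).
  by rewrite (quotientM qA) !sE.
- apply/continuousP => O oO.
  have -> : (r \o s) @^-1` O = q @` (r @^-1` O).
    apply/seteqP; split=> [z Oz|_ [g Og <-]]; first by exists (s z).
    by rewrite /preimage /= rs.
  by apply: oq; apply: open_comp oO => x _; exact: cr.
- move=> O oO.
  have -> : (r \o s) @` O = r @` (q @^-1` O).
    apply/seteqP; split=> [_ [z Oz <-]|_ [g Og <-]].
      by exists (s z) => //; rewrite /preimage /= sE.
    by exists (q g) => //=; rewrite rs.
  by apply: or; apply: open_comp oO => x _; exact: cq.
- by move=> w; have [g <-] := sr w; exists (q g); rewrite /= rs.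
- by move=> x; rewrite /= (quotient_ker rD) /preimage /= sE.
Qed.

End NearAbelian.

Theorem theorem3p6 (G Q : topGroup) (A : set G) (q : G -> Q) :
  periodic_group G -> near_abelian A q -> A_nontrivial A ->
  let GD := q @^-1` (@div_part Q) in
  [/\ A `<=` GD, GD `<=` centraliser A, normal_sub GD, abelian_set GD &
      forall (R : topGroup) (r : G -> R), is_quotient GD r -> Pi_procyclic R].
Proof.
move=> perG naG _ GD; split.
- exact: base_sub_div_part naG.
- exact: div_part_centralises naG.
- exact: div_part_preim_normal naG.
- exact: div_part_preim_abelian naG.
- exact: (quotient_div_part_preim perG naG).
Qed.
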